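(* For all formulas $\phi,\chi$: $\phi\vDash_{\mathrm{NFL}_{\mathbf{M}\omega}}\chi$ if and only if there is a tableaux proof of $\phi\vdash_{\mathrm{NFL}_{\mathbf{M}\omega}}\chi$ (in the calculus for $\mathbf{M}\omega$ described in the context).
   Context: Semantics: $\mathbf{M}\omega$ is the lattice consisting of a top $\top$, a bottom $\bot$, and countably infinitely many pairwise incomparable middle elements $\mathbf{1},\mathbf{2},\ldots,\mathbf{n},\ldots$. Formulas are built from propositional variables using $\neg,\wedge,\vee$; a valuation maps variables to $\mathbf{M}\omega$ and is extended by interpreting $\wedge,\vee$ as meet and join and $\neg$ by $\neg\top=\bot$, $\neg\bot=\top$, $\neg x=x$ for each middle element $x$. $\phi\vDash_{\mathrm{NFL}_{\mathbf{M}\omega}}\chi$ iff for every valuation $v$, $v(\phi)\neq\bot$ implies $v(\chi)\neq\bot$. Tableaux: a tableau is a downward branching tree whose nodes contain labelled formulas $\mathfrak{t}[\phi]$, $\mathfrak{m}[\phi]$, $\mathfrak{f}[\phi]$ and labelled pairs $\phi\sim\chi$, $\phi\nsim\chi$; branches are regarded as sets. A branch containing the premise(s) of a rule may be extended by the rule; conclusions separated by $\mid$ split the branch. Rules ($i\in\{1,2\}$, $p,q,r$ propositional variables, $\circ\in\{\wedge,\vee\}$): $(\mathfrak{t}\wedge)$: $\mathfrak{t}[\phi\wedge\chi]$ / $\mathfrak{t}[\phi],\mathfrak{t}[\chi]$. $(\mathfrak{t}\vee)$: $\mathfrak{t}[\phi\vee\chi]$ / $\mathfrak{t}[\phi]\mid\mathfrak{t}[\chi]\mid\mathfrak{m}[\phi],\mathfrak{m}[\chi],\phi\nsim\chi$.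 $(\mathfrak{t}\neg)$: $\mathfrak{t}[\neg\phi]$ / $\mathfrak{f}[\phi]$. $(\mathfrak{m}\wedge)$: $\mathfrak{m}[\phi\wedge\chi]$ / $\mathfrak{t}[\phi],\mathfrak{m}[\chi]\mid\mathfrak{m}[\phi],\mathfrak{t}[\chi]\mid\mathfrak{m}[\phi],\mathfrak{m}[\chi],\phi\sim\chi$. $(\mathfrak{m}\vee)$: $\mathfrak{m}[\phi\vee\chi]$ / $\mathfrak{f}[\phi],\mathfrak{m}[\chi]\mid\mathfrak{m}[\phi],\mathfrak{f}[\chi]\mid\mathfrak{m}[\phi],\mathfrak{m}[\chi],\phi\sim\chi$. $(\mathfrak{m}\neg)$: $\mathfrak{m}[\neg\phi]$ / $\mathfrak{m}[\phi],\phi\sim\neg\phi$. $(\mathfrak{f}\wedge)$: $\mathfrak{f}[\phi\wedge\chi]$ / $\mathfrak{f}[\phi]\mid\mathfrak{f}[\chi]\mid\mathfrak{m}[\phi],\mathfrak{m}[\chi],\phi\nsim\chi$. $(\mathfrak{f}\vee)$: $\mathfrak{f}[\phi\vee\chi]$ / $\mathfrak{f}[\phi],\mathfrak{f}[\chi]$. $(\mathfrak{f}\neg)$: $\mathfrak{f}[\neg\phi]$ / $\mathfrak{t}[\phi]$. $(\sim\mathsf{sym})$: $\phi\sim\chi$ / $\chi\sim\phi$; $(\nsim\mathsf{sym})$: $\phi\nsim\chi$ / $\chi\nsim\phi$. $(\sim\mathsf{trans})$: $p\sim q,q\sim r$ / $p\sim r$; $(\nsim\mathsf{trans})$: $p\nsim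 q,q\sim r$ / $p\nsim r$. $(\neg\sim)$: $\neg\phi\sim\chi$ / $\phi\sim\chi$; $(\neg\nsim)$: $\neg\phi\nsim\chi$ / $\phi\nsim\chi$. $(\circ\sim)$: $\phi\sim\chi_1\circ\chi_2,\mathfrak{m}[\chi_i]$ / $\phi\sim\chi_i$; $(\circ\nsim)$: $\phi\nsim\chi_1\circ\chi_2,\mathfrak{m}[\chi_i]$ / $\phi\nsim\chi_i$. A branch is closed iff it contains one of: (1) $\mathcal{M}[\phi]$ and $\mathcal{M}'[\phi]$ for distinct labels $\mathcal{M},\mathcal{M}'\in\{\mathfrak{t},\mathfrak{m},\mathfrak{f}\}$; (2) $\phi\sim\chi$ and $\phi\nsim\chi$; (3) $\phi\nsim\phi$. A tableau is closed iff all its branches are closed. There is a tableaux proof of $\phi\vdash_{\mathrm{NFL}_{\mathbf{M}\omega}}\chi$ iff there are closed tableaux beginning with $\{\mathfrak{m}[\phi],\mathfrak{f}[\chi]\}$ and with $\{\mathfrak{t}[\phi],\mathfrak{f}[\chi]\}$. *)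

(* Defs.v *)
From HB Require Import structures.
From mathcomp Require Import all_boot all_order.

Set Implicit Arguments.
Unset Strict Implicit.
Unset Printing Implicit Defensive.

Import Order.TTheory.
Local Open Scope order_scope.

(* The middle elements are numbered from 0: [Mid n] is the element n + 1. *)
Inductive Momega : Type := Bot | Mid of nat | Top.

Definition Momega_code (x : Momega) : option (option nat) :=
  match x with Bot => None | Mid n => Some (Some n) | Top => Some None end.

Definition Momega_decode (c : option (option nat)) : Momega :=
  match c with None => Bot | Some (Some n) => Mid n | Some None => Top end.

Lemma Momega_codeK : cancel Momega_code Momega_decode.
Proof. by case. Qed.

HB.instance Definition _ := Countable.copy Momega (can_type Momega_codeK).

Definition Momega_le (x y : Momega) : bool :=
  match x, y with
  | Bot, _ | _, Top => true
  | Mid m, Mid n => m == n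
  | _, _ => false
  end.

Definition Momega_meet (x y : Momega) : Momega :=
  if Momega_le x y then x else if Momega_le y x then y else Bot.

Definition Momega_join (x y : Momega) : Momega :=
  if Momega_le x y then y else if Momega_le y x then x else Top.

Lemma Momega_le_refl : reflexive Momega_le.
Proof. by case=> //= n. Qed.

Lemma Momega_le_anti : antisymmetric Momega_le.
Proof. by case=> [|m|] [|n|] //= /andP[/eqP-> _]. Qed.

Lemma Momega_le_trans : transitive Momega_le.
Proof. by case=> [|m|] [|n|] [|p|] //= /eqP->. Qed.

Fact Momega_display : Order.disp_t. Proof. exact: Order.Disp tt tt. Qed.

HB.instance Definition _ := Order.Le_isPOrder.Build Momega_display Momega
  Momega_le_refl Momega_le_anti Momega_le_trans.

Lemma Momega_meetP (x y z : Momega) :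
  (x <= Momega_meet y z) = (x <= y) && (x <= z).
Proof.
have leE a b : (a <= b) = Momega_le a b by [].
rewrite !leE /Momega_meet; case: ifP => yz.
  by case xy: (Momega_le x y); rewrite //= (Momega_le_trans xy yz).
case: ifP => zy.
  by case xz: (Momega_le x z); rewrite ?andbF //= (Momega_le_trans xz zy).
case: x y z yz zy => [|m|] [|n|] [|p|] //= np _.
by apply/esym/negP => /andP[/eqP mn /eqP mp]; rewrite -mn mp eqxx in np.
Qed.

Lemma Momega_joinP (x y z : Momega) :
  (Momega_join x y <= z) = (x <= z) && (y <= z).
Proof.
have leE a b : (a <= b) = Momega_le a b by [].
rewrite !leE /Momega_join; case: ifP => xy.
  by case yz: (Momega_le y z); rewrite ?andbF // (Momega_le_trans xy yz).
case: ifP => yx.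
  by case xz: (Momega_le x z); rewrite //= (Momega_le_trans yx xz).
case: x y z xy yx => [|m|] [|n|] [|p|] //= mn _.
by apply/esym/negP => /andP[/eqP mp /eqP np]; rewrite mp np eqxx in mn.
Qed.

HB.instance Definition _ := Order.POrder_MeetJoin_isLattice.Build
  Momega_display Momega Momega_meetP Momega_joinP.

Lemma Momega_le0x (x : Momega) : Bot <= x.
Proof. by []. Qed.

Lemma Momega_lex1 (x : Momega) : x <= Top.
Proof. by case: x. Qed.

HB.instance Definition _ :=
  Order.hasBottom.Build Momega_display Momega Momega_le0x.
HB.instance Definition _ :=
  Order.hasTop.Build Momega_display Momega Momega_lex1.

Definition Momega_neg (x : Momega) : Momega :=
  match x with Top => Bot | Bot => Top | Mid n => Mid n end.

Inductive formula : Type :=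
  | Var of nat
  | Neg of formula
  | And of formula & formula
  | Or of formula & formula.

Lemma formula_comparable : comparable formula.
Proof. by move=> x y; rewrite /decidable; decide equality; apply: eq_comparable. Qed.

HB.instance Definition _ :=
  hasDecEq.Build formula (compareP formula_comparable).

Fixpoint eval (v : nat -> Momega) (phi : formula) : Momega :=
  match phi with
  | Var p => v p
  | Neg phi1 => Momega_neg (eval v phi1)
  | And phi1 phi2 => eval v phi1 `&` eval v phi2
  | Or phi1 phi2 => eval v phi1 `|` eval v phi2
  end.

Definition entails (phi chi : formula) : Prop :=
  forall v : nat -> Momega, eval v phi <> \bot -> eval v chi <> \bot.

Inductive label : Type := Lt | Lm | Lf.

Lemma label_comparable : comparable label.
Proof. by move=> x y; rewrite /decidable; decide equality. Qed.

HB.instance Definition _ := hasDecEq.Build label (compareP label_comparable).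

Inductive item : Type :=
  | Lab of label & formula
  | Sim of formula & formula
  | Nsim of formula & formula.

Lemma item_comparable : comparable item.
Proof. by move=> x y; rewrite /decidable; decide equality; apply: eq_comparable. Qed.

HB.instance Definition _ := hasDecEq.Build item (compareP item_comparable).

(* [rule ps css]: from premises [ps], split into one branch per element of
   [css], each element listing the conclusions added on that branch. *)
Inductive rule : seq item -> seq (seq item) -> Prop :=
  | t_and phi chi :
      rule [:: Lab Lt (And phi chi)] [:: [:: Lab Lt phi; Lab Lt chi]]
  | t_or phi chi :
      rule [:: Lab Lt (Or phi chi)]
           [:: [:: Lab Lt phi]; [:: Lab Lt chi];
               [:: Lab Lm phi; Lab Lm chi; Nsim phi chi]]
  | t_neg phi :
      rule [:: Lab Lt (Neg phi)] [:: [:: Lab Lf phi]]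
  | m_and phi chi :
      rule [:: Lab Lm (And phi chi)]
           [:: [:: Lab Lt phi; Lab Lm chi]; [:: Lab Lm phi; Lab Lt chi];
               [:: Lab Lm phi; Lab Lm chi; Sim phi chi]]
  | m_or phi chi :
      rule [:: Lab Lm (Or phi chi)]
           [:: [:: Lab Lf phi; Lab Lm chi]; [:: Lab Lm phi; Lab Lf chi];
               [:: Lab Lm phi; Lab Lm chi; Sim phi chi]]
  | m_neg phi :
      rule [:: Lab Lm (Neg phi)] [:: [:: Lab Lm phi; Sim phi (Neg phi)]]
  | f_and phi chi :
      rule [:: Lab Lf (And phi chi)]
           [:: [:: Lab Lf phi]; [:: Lab Lf chi];
               [:: Lab Lm phi; Lab Lm chi; Nsim phi chi]]
  | f_or phi chi :
      rule [:: Lab Lf (Or phi chi)] [:: [:: Lab Lf phi; Lab Lf chi]]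
  | f_neg phi :
      rule [:: Lab Lf (Neg phi)] [:: [:: Lab Lt phi]]
  | sim_sym phi chi :
      rule [:: Sim phi chi] [:: [:: Sim chi phi]]
  | nsim_sym phi chi :
      rule [:: Nsim phi chi] [:: [:: Nsim chi phi]]
  | sim_trans p q r :
      rule [:: Sim (Var p) (Var q); Sim (Var q) (Var r)]
           [:: [:: Sim (Var p) (Var r)]]
  | nsim_trans p q r :
      rule [:: Nsim (Var p) (Var q); Sim (Var q) (Var r)]
           [:: [:: Nsim (Var p) (Var r)]]
  | neg_sim phi chi :
      rule [:: Sim (Neg phi) chi] [:: [:: Sim phi chi]]
  | neg_nsim phi chi :
      rule [:: Nsim (Neg phi) chi] [:: [:: Nsim phi chi]]
  | bin_sim op phi chi1 chi2 chi of
        op = And \/ op = Or & chi = chi1 \/ chi = chi2 :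
      rule [:: Sim phi (op chi1 chi2); Lab Lm chi] [:: [:: Sim phi chi]]
  | bin_nsim op phi chi1 chi2 chi of
        op = And \/ op = Or & chi = chi1 \/ chi = chi2 :
      rule [:: Nsim phi (op chi1 chi2); Lab Lm chi] [:: [:: Nsim phi chi]].

Inductive tree : Type := Node of seq item & seq tree.

Definition content (T : tree) : seq item := let: Node c _ := T in c.

(* [B] collects the items on the path leading to, but excluding, the root
   of [T]. *)
Fixpoint grows_by_rules (B : seq item) (T : tree) : Prop :=
  let: Node c ts := T in
  (ts = [::] \/
   exists ps, rule ps (map content ts) /\ {subset ps <= B ++ c}) /\
  foldr (fun t P => grows_by_rules (B ++ c) t /\ P) True ts.

Definition tableau (G : seq item) (T : tree) : Prop :=
  content T = G /\ grows_by_rules [::] T.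

Fixpoint branches (T : tree) : seq (seq item) :=
  match T with
  | Node c [::] => [:: c]
  | Node c ts => [seq c ++ b | b <- flatten (map branches ts)]
  end.

Definition closed_branch (b : seq item) : Prop :=
  [\/ exists l l' phi, [/\ l <> l', Lab l phi \in b & Lab l' phi \in b],
      exists phi chi, Sim phi chi \in b /\ Nsim phi chi \in b
    | exists phi, Nsim phi phi \in b].

Definition closed_tableau (T : tree) : Prop :=
  forall b, b \in branches T -> closed_branch b.

Definition tableaux_proof (phi chi : formula) : Prop :=
  (exists T, tableau [:: Lab Lm phi; Lab Lf chi] T /\ closed_tableau T) /\
  (exists T, tableau [:: Lab Lt phi; Lab Lf chi] T /\ closed_tableau T).

(* Main.v *)
(* Soundness: every rule preserves satisfaction by a fixed valuation along some
   branch. Completeness: the rules stay within the finite set of items over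
   subformulas, so an unsatisfiable branch can be extended until it closes;
   otherwise one reaches an open saturated branch. On such a branch ~ restricted
   to variables is an equivalence, and sending each middle variable to the least
   member of its class gives a valuation making all labels true. *)

Require Import Defs.
From mathcomp Require Import all_boot all_order.
From Stdlib Require Import Classical.

Set Implicit Arguments.
Unset Strict Implicit.
Unset Printing Implicit Defensive.

Import Order.TTheory.

(** * Truth of items under a valuation and soundness of tableaux *)

Lemma meetE (x y : Momega) : Order.meet x y = Momega_meet x y.
Proof. by []. Qed.

Lemma joinE (x y : Momega) : Order.join x y = Momega_join x y.
Proof. by []. Qed.

Lemma Mid_eqE m n : (Mid m == Mid n) = (m == n).
Proof. by apply/eqP/eqP => [[]|->]. Qed.

Lemma meet_Mid m n :
  Momega_meet (Mid m) (Mid n) = if m == n then Mid m else Bot.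
Proof. by rewrite /Momega_meet /= [n == m]eq_sym; have [->|] := eqVneq m n. Qed.

Lemma join_Mid m n :
  Momega_join (Mid m) (Mid n) = if m == n then Mid m else Top.
Proof. by rewrite /Momega_join /= [n == m]eq_sym; have [->|] := eqVneq m n. Qed.

Definition has_label (l : label) (x : Momega) : bool :=
  match l, x with Lt, Top | Lm, Mid _ | Lf, Bot => true | _, _ => false end.

(** A pair also asserts that both values are middle. Otherwise the rules stripping [Neg], [And] or
    [Or] from a pair would be unsound, since [Momega_neg] swaps the extreme values and distinct
    middle elements meet in [Bot] and join in [Top]. *)
Definition sat (v : nat -> Momega) (i : item) : bool :=
  match i with
  | Lab l phi => has_label l (eval v phi)
  | Sim phi chi => has_label Lm (eval v phi) && (eval v phi == eval v chi)
  | Nsim phi chi => [&& has_label Lm (eval v phi), has_label Lm (eval v chi)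
                      & eval v phi != eval v chi]
  end.

Lemma rule_sound v ps css :
  rule ps css -> all (sat v) ps -> has (all (sat v)) css.
Proof.
case=> {ps css}.
- move=> a b /=; rewrite meetE.
  move: (eval v a) (eval v b) => [|m|] [|n|] //=.
  by rewrite meet_Mid; case: ifP.
- move=> a b /=; rewrite joinE.
  move: (eval v a) (eval v b) => [|m|] [|n|] //=.
  by rewrite join_Mid Mid_eqE; case: ifP.
- by move=> a /=; case: (eval v a).
- move=> a b /=; rewrite meetE.
  move: (eval v a) (eval v b) => [|m|] [|n|] //=.
  by rewrite meet_Mid Mid_eqE; case: ifP.
- move=> a b /=; rewrite joinE.
  move: (eval v a) (eval v b) => [|m|] [|n|] //=.
  by rewrite join_Mid Mid_eqE; case: ifP.
- by move=> a /=; case: (eval v a) => [|m|] //=; rewrite eqxx.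
- move=> a b /=; rewrite meetE.
  move: (eval v a) (eval v b) => [|m|] [|n|] //=.
  by rewrite meet_Mid Mid_eqE; case: ifP.
- move=> a b /=; rewrite joinE.
  move: (eval v a) (eval v b) => [|m|] [|n|] //=.
  by rewrite join_Mid; case: ifP.
- by move=> a /=; case: (eval v a).
- by move=> a b /=; rewrite !andbT !orbF => /andP[H /eqP <-]; rewrite H eqxx.
- by move=> a b /=; rewrite !andbT !orbF eq_sym andbCA => ->.
- move=> p q r /=; rewrite !andbT !orbF => /andP[/andP[-> /eqP->] /andP[_ ->]].
  by [].
- move=> p q r /=; rewrite !andbT !orbF.
  by move=> /andP[/and3P[-> Hq Hpq] /andP[_ /eqP <-]]; rewrite Hq.
- by move=> a b /=; case: (eval v a) => [|m|] //=; rewrite !andbT !orbF.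
- by move=> a b /=; case: (eval v a) => [|m|] //=; rewrite !andbT !orbF.
(* If a meet or join and one of its arguments are both middle, they are equal. *)
- move=> op a c1 c2 c Hop Hc /=; rewrite !andbT !orbF.
  case/andP => /andP[Ha /eqP Hac]; move: Ha; rewrite Hac.
  case: Hop => ->; case: Hc => -> /=; rewrite ?meetE ?joinE;
    move: (eval v c1) (eval v c2) => [|m|] [|n|] //=;
    rewrite ?eqxx // ?meet_Mid ?join_Mid; have [->|] := eqVneq m n;
    by rewrite ?eqxx.
- move=> op a c1 c2 c Hop Hc /=; rewrite !andbT !orbF.
  case/andP => /and3P[-> + +].
  case: Hop => ->; case: Hc => -> /=; rewrite ?meetE ?joinE;
    move: (eval v c1) (eval v c2) => [|m|] [|n|] //=;
    rewrite ?eqxx // ?meet_Mid ?join_Mid; have [->|] := eqVneq m n;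
    by rewrite ?eqxx.
Qed.

Lemma closed_branch_unsat v b : closed_branch b -> ~~ all (sat v) b.
Proof.
move=> Hb; apply/negP => /allP Hs; case: Hb.
- case=> l [l' [phi [ne /Hs /= H /Hs /= H']]].
  by apply: ne; move: H H'; case: l l' (eval v phi) => [] [] [].
- case=> phi [chi [/Hs /= /andP[_ H] /Hs /= /and3P[_ _]]].
  by rewrite H.
- by case=> phi /Hs /= /and3P[_ _]; rewrite eqxx.
Qed.

(** Children sit inside a list, so the induction hypotheses for them are gathered by a [foldr], in
    the shape that [grows_by_rules] uses. *)
Lemma tree_nested_ind (P : tree -> Prop) :
  (forall c ts, foldr (fun t Q => P t /\ Q) True ts -> P (Node c ts)) ->
  forall T, P T.
Proof.
move=> H; fix IH 1; case=> c ts; apply: H.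
by elim: ts => //= t ts IHts; split.
Qed.

Lemma branches_Node c t ts : branches (Node c (t :: ts)) =
  [seq c ++ b | b <- flatten (map branches (t :: ts))].
Proof. by []. Qed.

(** At each node of a satisfied path, soundness of the rule applied there yields a satisfied child;
    descending reaches a leaf. *)
Lemma grows_by_rules_sound v T B :
  grows_by_rules B T -> all (sat v) (B ++ content T) ->
  exists2 b, b \in branches T & all (sat v) (B ++ b).
Proof.
elim/tree_nested_ind: T B => c [|t0 ts0] IH B [Hr Hts] Hs.
  by exists c; rewrite ?inE.
case: Hr => // -[ps [Hr Hps]]; rewrite branches_Node.
move: (t0 :: ts0) IH Hts Hr => ts IH Hts Hr.
have /(rule_sound Hr) Hhas : all (sat v) ps.
  by apply/allP => i /Hps; exact/allP.
suff [b Hb Hsb] : exists2 b, b \in flatten (map branches ts)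
    & all (sat v) ((B ++ c) ++ b).
  by exists (c ++ b); rewrite ?catA //; apply: map_f.
elim: ts IH Hts Hhas {Hr} => //= t ts IHts [IHt IH] [Ht Hts].
case/orP => [Hc|Hc].
  have [||b Hb Hsb] := IHt (B ++ c) => //.
    by rewrite all_cat Hs.
  by exists b; rewrite // mem_cat Hb.
have [b Hb Hsb] := IHts IH Hts Hc.
by exists b; rewrite // mem_cat Hb orbT.
Qed.

Lemma closed_tableau_unsat v G T :
  tableau G T -> closed_tableau T -> ~~ all (sat v) G.
Proof.
move=> [<- HT] Hcl; apply/negP => /(grows_by_rules_sound HT)[b /Hcl Hb].
by apply/negP/closed_branch_unsat.
Qed.

(** * Closed subtableaux below a given path *)

(** [B] is the path above the root; for [B] empty this is a closed tableau beginning with [c]. *)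
Definition closable (B c : seq item) : Prop :=
  exists T, [/\ content T = c, grows_by_rules B T &
    forall b, b \in branches T -> closed_branch (B ++ b)].

Lemma closable_closed B c : closed_branch (B ++ c) -> closable B c.
Proof.
move=> H; exists (Node c [::]); split => //=; first by split; [left|].
by move=> b; rewrite inE => /eqP->.
Qed.

Lemma closable_rule B c ps css :
  rule ps css -> {subset ps <= B ++ c} ->
  (forall d, d \in css -> closable (B ++ c) d) -> closable B c.
Proof.
move=> Hr Hps Hcss.
have [ts [Ec Hg Hb]] : exists ts, [/\ map content ts = css,
    foldr (fun t P => grows_by_rules (B ++ c) t /\ P) True ts &
    forall b, b \in flatten (map branches ts) ->
      closed_branch ((B ++ c) ++ b)].
  elim: css Hcss {Hr} => [|d css IH] H; first by exists [::].
  have [|ts [E Hg Hb]] := IH; first by move=> e He; apply: H; rewrite inE He orbT.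
  have [|T [ET HT HbT]] := H d; first by rewrite mem_head.
  exists (T :: ts); split; rewrite /= ?E ?ET //.
  by move=> b; rewrite mem_cat => /orP[/HbT|/Hb].
(* A node without children would be a leaf and contribute the branch [c] itself; every rule has at
   least one alternative. *)
have ts_neq0 : ts <> [::] by move=> E; rewrite -Ec E in Hr; inversion Hr.
exists (Node c ts); split => //=.
  by split => //; right; exists ps; rewrite Ec.
move=> b; case: ts ts_neq0 Hb {Ec Hg} => // t ts _ Hb.
by case/mapP => b' /Hb H ->; rewrite catA.
Qed.

(** * The canonical model of an open saturated branch *)

Definition saturated (b : seq item) : Prop :=
  forall ps css, rule ps css -> {subset ps <= b} ->
  exists2 c, c \in css & {subset c <= b}.

Section CanonicalModel.
Variable b : seq item.
Hypotheses (b_open : ~ closed_branch b) (b_sat : saturated b).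

Let b_rule1 p c : rule [:: p] [:: c] -> p \in b -> {subset c <= b}.
Proof.
move=> Hr Hp; have [|d] := b_sat Hr; first by move=> i; rewrite inE => /eqP->.
by rewrite inE => /eqP->.
Qed.

Let b_rule2 p q c :
  rule [:: p; q] [:: c] -> p \in b -> q \in b -> {subset c <= b}.
Proof.
move=> Hr Hp Hq; have [|d] := b_sat Hr.
  by move=> i; rewrite !inE => /orP[]/eqP->.
by rewrite inE => /eqP->.
Qed.

Let b_rule3 p c d e : rule [:: p] [:: c; d; e] -> p \in b ->
  [\/ {subset c <= b}, {subset d <= b} | {subset e <= b}].
Proof.
move=> Hr Hp; have [|f] := b_sat Hr; first by move=> i; rewrite inE => /eqP->.
by rewrite !inE => /or3P[]/eqP->;
  [constructor 1|constructor 2|constructor 3].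
Qed.

(** Equality is added since the branch need not contain a pair of a variable with itself. *)
Definition same_class p q := (p == q) || (Sim (Var p) (Var q) \in b).

Lemma same_class_ex p : exists q, same_class p q.
Proof. by exists p; rewrite /same_class eqxx. Qed.

Lemma same_class_sym p q : same_class p q -> same_class q p.
Proof.
case/orP => [/eqP->|H]; rewrite /same_class ?eqxx //.
by rewrite (b_rule1 (sim_sym _ _) H) ?orbT // mem_head.
Qed.

Lemma same_class_trans p q r :
  same_class p q -> same_class q r -> same_class p r.
Proof.
case/orP => [/eqP->//|H]; case/orP => [/eqP<-|K]; rewrite /same_class.
  by rewrite H orbT.
by rewrite (b_rule2 (sim_trans _ _ _) H K) ?orbT // mem_head.
Qed.

(** The least variable of a class serves as its number. Unlabelled variables also fall in the last
    case, which makes the valuation total. *)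
Definition canonical_val p : Momega :=
  if Lab Lt (Var p) \in b then Top
  else if Lab Lf (Var p) \in b then Bot
  else Mid (ex_minn (same_class_ex p)).

Lemma label_inj l l' phi : Lab l phi \in b -> Lab l' phi \in b -> l = l'.
Proof.
move=> H H'; apply/eqP/negP => /negP/eqP ne.
by apply: b_open; constructor 1; exists l, l', phi.
Qed.

Lemma canonical_val_m p : Lab Lm (Var p) \in b ->
  canonical_val p = Mid (ex_minn (same_class_ex p)).
Proof.
move=> H; rewrite /canonical_val.
case: ifP => [/(label_inj H)//|_].
by case: ifP => [/(label_inj H)//|_].
Qed.

Lemma canonical_val_sim p q : Lab Lm (Var p) \in b -> Lab Lm (Var q) \in b ->
  Sim (Var p) (Var q) \in b -> canonical_val p = canonical_val q.
Proof.
move=> /canonical_val_m-> /canonical_val_m-> H; congr Mid.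
have pq : same_class p q by rewrite /same_class H orbT.
apply: eq_ex_minn => r; apply/idP/idP.
  exact/same_class_trans/same_class_sym.
exact: same_class_trans.
Qed.

(** Equal least members would put both variables in one class; then they coincide or are related by
    [Sim], and the branch closes either way. *)
Lemma canonical_val_nsim p q : Lab Lm (Var p) \in b -> Lab Lm (Var q) \in b ->
  Nsim (Var p) (Var q) \in b -> canonical_val p <> canonical_val q.
Proof.
move=> /canonical_val_m-> /canonical_val_m-> H [].
case: ex_minnP => m /same_class_sym pm _; case: ex_minnP => n qn _ mn.
subst n; have := same_class_trans qn pm; case/orP => [/eqP E|K].
  by apply: b_open; constructor 3; exists (Var p); rewrite -{2}E.
apply: b_open; constructor 2; exists (Var q), (Var p); split => //.
by apply: (b_rule1 (nsim_sym _ _) H); rewrite mem_head.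
Qed.

Notation ev := (eval canonical_val).

(* A formula labelled m traces back to a middle variable with the same value,
   to which its pairs can be transferred. *)
Definition middle_leaf phi p := [/\ Lab Lm (Var p) \in b,
  ev phi = canonical_val p,
  forall chi, Sim chi phi \in b -> Sim chi (Var p) \in b &
  forall chi, Nsim chi phi \in b -> Nsim chi (Var p) \in b].

Lemma middle_leaf_label phi p : middle_leaf phi p -> has_label Lm (ev phi).
Proof. by case=> /canonical_val_m E -> _ _; rewrite E. Qed.

(** Transfers act on the right component only: [chi] is moved to [q], the pair is flipped, and then
    [phi] is moved to [p]. *)
Lemma middle_leaf_sim phi chi p q : middle_leaf phi p -> middle_leaf chi q ->
  Sim phi chi \in b -> ev phi = ev chi.
Proof.
move=> [mp -> sp _] [mq -> sq _] /sq H; symmetry; apply: canonical_val_sim => //.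
by apply/sp/(b_rule1 (sim_sym _ _) H); rewrite mem_head.
Qed.

Lemma middle_leaf_nsim phi chi p q : middle_leaf phi p -> middle_leaf chi q ->
  Nsim phi chi \in b -> ev phi <> ev chi.
Proof.
move=> [mp -> _ sp] [mq -> _ sq] /sq H; apply: nesym.
apply: canonical_val_nsim => //.
by apply/sp/(b_rule1 (nsim_sym _ _) H); rewrite mem_head.
Qed.

Lemma middle_leaf_neg phi p : middle_leaf phi p -> middle_leaf (Neg phi) p.
Proof.
move=> [mp E s n]; split => // [|chi H|chi H].
- by rewrite /= E (canonical_val_m mp).
(* [neg_sim] strips a negation on the left, while here it stands on the right, hence the flips
   before and after. *)
- apply: s.
  have H1 := b_rule1 (sim_sym _ _) H (mem_head _ _).
  have H2 := b_rule1 (neg_sim _ _) H1 (mem_head _ _).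
  exact: (b_rule1 (sim_sym _ _) H2 (mem_head _ _)).
- apply: n.
  have H1 := b_rule1 (nsim_sym _ _) H (mem_head _ _).
  have H2 := b_rule1 (neg_nsim _ _) H1 (mem_head _ _).
  exact: (b_rule1 (nsim_sym _ _) H2 (mem_head _ _)).
Qed.

(** [bin_sim] and [bin_nsim] pass pairs from the compound to its middle argument [phi], whose leaf
    then serves the compound too. *)
Lemma middle_leaf_bin op phi1 phi2 phi p :
  op = And \/ op = Or -> phi = phi1 \/ phi = phi2 ->
  Lab Lm phi \in b -> ev (op phi1 phi2) = ev phi ->
  middle_leaf phi p -> middle_leaf (op phi1 phi2) p.
Proof.
move=> Hop Hphi mphi E [mp Ep s n]; split => // [|chi H|chi H].
- by rewrite E.
- by apply/s/(b_rule2 (bin_sim _ Hop Hphi) H mphi)/mem_head.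
- by apply/n/(b_rule2 (bin_nsim _ Hop Hphi) H mphi)/mem_head.
Qed.

Definition faithful phi :=
  (forall l, Lab l phi \in b -> has_label l (ev phi)) /\
  (Lab Lm phi \in b -> exists p, middle_leaf phi p).

(** Knowing that values are middle is too weak for the induction: comparing two middle subformulas
    requires carrying the pair between them down to variables, which the leaves make possible. *)
Lemma faithfulP phi : faithful phi.
Proof.
have top x : has_label Lt x -> x = Top by case: x.
have bot x : has_label Lf x -> x = Bot by case: x.
have mid x : has_label Lm x -> exists n, x = Mid n by case: x => // n _; exists n.
suff H : (Lab Lt phi \in b -> has_label Lt (ev phi)) /\
    (Lab Lf phi \in b -> has_label Lf (ev phi)) /\
    (Lab Lm phi \in b -> exists p, middle_leaf phi p).
  case: H => Ht [Hf Hm]; split => //; case=> //.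
  by move=> /Hm[p /middle_leaf_label].
elim: phi => [p|phi [Ht [Hf Hm]]|phi [Ht [Hf Hm]] chi [Kt [Kf Km]]
                                |phi [Ht [Hf Hm]] chi [Kt [Kf Km]]].
- split; [|split] => [H|H|H].
  + by rewrite /= /canonical_val H.
  + rewrite /= /canonical_val H; case: ifP => // K.
    by have := label_inj H K.
  + by exists p.
- split; [|split] => /= [H|H|H].
  + have /Hf/bot-> // : Lab Lf phi \in b.
    exact: (b_rule1 (t_neg _) H (mem_head _ _)).
  + have /Ht/top-> // : Lab Lt phi \in b.
    exact: (b_rule1 (f_neg _) H (mem_head _ _)).
  + have /Hm[p Hp] : Lab Lm phi \in b.
      exact: (b_rule1 (m_neg _) H (mem_head _ _)).
    by exists p; apply: middle_leaf_neg.
- have And_op : And = And \/ And = Or by left.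
  split; [|split] => /= [H|H|H]; rewrite ?meetE.
  + have s := b_rule1 (t_and _ _) H.
    by rewrite (top _ (Ht _)) ?(top _ (Kt _)) // s ?inE ?eqxx ?orbT.
  + case: (b_rule3 (f_and _ _) H) => s.
    * by rewrite (bot _ (Hf _)) // s ?inE.
    * by rewrite (bot _ (Kf _)) ?s ?inE //; case: (ev phi).
    (* The [Nsim] pair makes the two middle values distinct, so they meet in [Bot]. *)
    * have [|p Hp] := Hm; first by rewrite s ?inE ?eqxx.
      have [|q Hq] := Km; first by rewrite s ?inE ?eqxx ?orbT.
      have := middle_leaf_nsim Hp Hq (s _ _).
      rewrite !inE eqxx !orbT => /(_ isT).
      have [m ->] := mid _ (middle_leaf_label Hp).
      have [n ->] := mid _ (middle_leaf_label Hq).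
      by rewrite meet_Mid; case: eqP => // ->.
  + case: (b_rule3 (m_and _ _) H) => s.
    (* [Top] is neutral for meet, so the compound takes the value and the leaf of its middle
       conjunct. *)
    * have mchi : Lab Lm chi \in b by rewrite s ?inE ?eqxx ?orbT.
      have [p Hp] := Km mchi; exists p.
      apply: (middle_leaf_bin And_op (or_intror erefl) mchi _ Hp).
      rewrite /= (top _ (Ht _)) ?s ?inE ?eqxx // meetE.
      by have [n ->] := mid _ (middle_leaf_label Hp).
    * have mphi : Lab Lm phi \in b by rewrite s ?inE ?eqxx.
      have [p Hp] := Hm mphi; exists p.
      apply: (middle_leaf_bin And_op (or_introl erefl) mphi _ Hp).
      rewrite /= (top _ (Kt _)) ?s ?inE ?eqxx ?orbT // meetE.
      by have [n ->] := mid _ (middle_leaf_label Hp).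
    (* The [Sim] pair gives both conjuncts the same value, so the leaf of [phi] serves. *)
    * have mphi : Lab Lm phi \in b by rewrite s ?inE ?eqxx.
      have mchi : Lab Lm chi \in b by rewrite s ?inE ?eqxx ?orbT.
      have [p Hp] := Hm mphi; have [q Hq] := Km mchi; exists p.
      apply: (middle_leaf_bin And_op (or_introl erefl) mphi _ Hp).
      rewrite /= -(middle_leaf_sim Hp Hq) ?meetxx //.
      by rewrite s // !inE eqxx !orbT.
- have Or_op : Or = And \/ Or = Or by right.
  split; [|split] => /= [H|H|H]; rewrite ?joinE.
  + case: (b_rule3 (t_or _ _) H) => s.
    * by rewrite (top _ (Ht _)) ?s ?inE //; case: (ev chi).
    * by rewrite (top _ (Kt _)) ?s ?inE //; case: (ev phi).
    * have [|p Hp] := Hm; first by rewrite s ?inE ?eqxx.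
      have [|q Hq] := Km; first by rewrite s ?inE ?eqxx ?orbT.
      have := middle_leaf_nsim Hp Hq (s _ _).
      rewrite !inE eqxx !orbT => /(_ isT).
      have [m ->] := mid _ (middle_leaf_label Hp).
      have [n ->] := mid _ (middle_leaf_label Hq).
      by rewrite join_Mid; case: eqP => // ->.
  + have s := b_rule1 (f_or _ _) H.
    by rewrite (bot _ (Hf _)) ?(bot _ (Kf _)) // s ?inE ?eqxx ?orbT.
  + case: (b_rule3 (m_or _ _) H) => s.
    (* Dually, [Bot] is neutral for join. *)
    * have mchi : Lab Lm chi \in b by rewrite s ?inE ?eqxx ?orbT.
      have [p Hp] := Km mchi; exists p.
      apply: (middle_leaf_bin Or_op (or_intror erefl) mchi _ Hp).
      by rewrite /= (bot _ (Hf _)) ?s ?inE ?eqxx.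
    * have mphi : Lab Lm phi \in b by rewrite s ?inE ?eqxx.
      have [p Hp] := Hm mphi; exists p.
      apply: (middle_leaf_bin Or_op (or_introl erefl) mphi _ Hp).
      rewrite /= (bot _ (Kf _)) ?s ?inE ?eqxx ?orbT // joinE.
      by have [n ->] := mid _ (middle_leaf_label Hp).
    * have mphi : Lab Lm phi \in b by rewrite s ?inE ?eqxx.
      have mchi : Lab Lm chi \in b by rewrite s ?inE ?eqxx ?orbT.
      have [p Hp] := Hm mphi; have [q Hq] := Km mchi; exists p.
      apply: (middle_leaf_bin Or_op (or_introl erefl) mphi _ Hp).
      rewrite /= -(middle_leaf_sim Hp Hq) ?joinxx //.
      by rewrite s // !inE eqxx !orbT.
Qed.

Lemma open_saturated_model :
  exists v, forall l phi, Lab l phi \in b -> sat v (Lab l phi).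
Proof.
exists canonical_val => l phi H; exact: (faithfulP phi).1.
Qed.

End CanonicalModel.

(** * Subformulas and the finite stock of items over them *)

Fixpoint subformulas (phi : formula) : seq formula :=
  phi :: match phi with
  | Var _ => [::]
  | Neg phi1 => subformulas phi1
  | And phi1 phi2 | Or phi1 phi2 => subformulas phi1 ++ subformulas phi2
  end.

Definition formulas_of (i : item) : seq formula :=
  match i with
  | Lab _ phi => [:: phi]
  | Sim phi chi | Nsim phi chi => [:: phi; chi]
  end.

Definition immediate (phi : formula) : seq formula :=
  match phi with
  | Var _ => [::]
  | Neg phi1 => [:: phi1]
  | And phi1 phi2 | Or phi1 phi2 => [:: phi1; phi2]
  end.

Definition subformula_closed (S : seq formula) : Prop :=
  forall phi, phi \in S -> {subset immediate phi <= S}.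

Lemma subformulas_refl phi : phi \in subformulas phi.
Proof. by case: phi => *; rewrite /= mem_head. Qed.

Lemma subformula_closed_cat S1 S2 : subformula_closed S1 ->
  subformula_closed S2 -> subformula_closed (S1 ++ S2).
Proof.
move=> H1 H2 phi; rewrite mem_cat => /orP[/H1 H|/H2 H] psi /H;
by rewrite mem_cat => -> //; rewrite orbT.
Qed.

Lemma subformula_closed_cons phi S : subformula_closed S ->
  {subset immediate phi <= S} -> subformula_closed (phi :: S).
Proof.
move=> HS Hphi psi; rewrite inE => /orP[/eqP->|/HS H] x.
  by move=> /Hphi Hx; rewrite inE Hx orbT.
by move=> /H Hx; rewrite inE Hx orbT.
Qed.

Lemma subformulas_closed phi : subformula_closed (subformulas phi).
Proof.
elim: phi => [p|phi IH|phi IH chi IH'|phi IH chi IH'] /=;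
  apply: subformula_closed_cons => //=; try exact: subformula_closed_cat.
- by move=> x; rewrite inE => /eqP->; apply: subformulas_refl.
- by move=> x; rewrite !inE mem_cat => /orP[]/eqP->;
    rewrite subformulas_refl ?orbT.
- by move=> x; rewrite !inE mem_cat => /orP[]/eqP->;
    rewrite subformulas_refl ?orbT.
Qed.

Definition over (S : seq formula) (i : item) : bool :=
  all (mem S) (formulas_of i).

(** Conclusions mention only formulas of the premises and their immediate subformulas. *)
Lemma rule_over S ps css : subformula_closed S -> rule ps css ->
  all (over S) ps -> all (all (over S)) css.
Proof.
move=> HS.
have HN a : Neg a \in S -> a \in S by move=> /HS; apply; rewrite mem_head.
have HA a c : And a c \in S -> (a \in S) && (c \in S).
  by move=> /HS H; rewrite !H ?inE ?eqxx ?orbT.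
have HO a c : Or a c \in S -> (a \in S) && (c \in S).
  by move=> /HS H; rewrite !H ?inE ?eqxx ?orbT.
case=> {ps css} >; rewrite /over /= ?andbT;
  solve [ by move=> /HA/andP[-> ->] | by move=> /HO/andP[-> ->]
        | by move=> /HN-> | by move=> H; rewrite H (HN _ H)
        | by case/andP => /HN-> -> | by case/andP => /andP[-> _] /andP[_ ->]
        | by move=> _ _ /andP[/andP[-> _] ->] | by case/andP => -> -> ].
Qed.

(** The members still missing from a branch are counted as the termination measure. *)
Definition items_over (S : seq formula) : seq item :=
  [seq Lab l phi | l <- [:: Lt; Lm; Lf], phi <- S] ++
  [seq Sim phi chi | phi <- S, chi <- S] ++
  [seq Nsim phi chi | phi <- S, chi <- S].

Lemma over_mem S i : over S i -> i \in items_over S.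
Proof.
rewrite /over; case: i => [l phi|phi chi|phi chi] /=;
  rewrite /items_over !mem_cat.
- by rewrite andbT => H; case: l; rewrite (map_f (Lab _) H) ?orbT.
- case/and3P => H K _; apply/orP; right; apply/orP; left; apply/allpairsP.
  by exists (phi, chi).
- case/and3P => H K _; apply/orP; right; apply/orP; right; apply/allpairsP.
  by exists (phi, chi).
Qed.

(** * Exhaustive extension of a branch, and the equivalence *)

Lemma ltn_count (T : eqType) (a1 a2 : pred T) (s : seq T) x :
  subpred a1 a2 -> x \in s -> a2 x -> ~~ a1 x -> count a1 s < count a2 s.
Proof.
move=> sub12 + a2x /negPf a1x.
elim: s => //= y s IH; rewrite inE => /orP[/eqP<-|/IH lt_s].
  by rewrite a2x a1x ltnS sub_count.
by rewrite -addnS leq_add //; case: (a1 y) (sub12 y) => // ->.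
Qed.

(** Pairs are left out: the canonical model is only shown to satisfy labelled formulas, and the
    initial sets contain nothing else. *)
Definition label_satisfiable (b : seq item) : Prop :=
  exists v, forall l phi, Lab l phi \in b -> sat v (Lab l phi).

(** Induction on the number of items over [S] missing from the branch. A branch neither closed nor
    saturated admits a rule none of whose alternatives is already present; applying it enlarges
    every branch and keeps it unsatisfiable. *)
Lemma unsatisfiable_closable S B c : subformula_closed S ->
  all (over S) (B ++ c) -> ~ label_satisfiable (B ++ c) -> closable B c.
Proof.
move=> HS.
have [n] := ubnP (count [pred i | i \notin B ++ c] (items_over S)).
elim: n => // n IH in B c * => le_n Hover Hunsat.
have [/closable_closed//|Hopen] := classic (closed_branch (B ++ c)).
have [Hsat|] := classic (saturated (B ++ c)).
  by case: Hunsat; exact: open_saturated_model.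
move=> /not_all_ex_not[ps /not_all_ex_not[css Hns]].
have [Hr {}Hns] := imply_to_and _ _ Hns.
have [Hps {}Hns] := imply_to_and _ _ Hns.
apply: (closable_rule Hr Hps) => d Hd.
have Hoverd : all (over S) d.
  apply: (allP (rule_over HS Hr _)) Hd.
  by apply/allP => i /Hps; exact/allP.
(* The new item [x] is what makes the measure drop strictly. *)
have /allPn[x xd xbc] : ~~ all (mem (B ++ c)) d.
  by apply/negP => /allP Hsub; apply: Hns; exists d.
apply: IH.
- rewrite -ltnS; apply: leq_trans le_n; rewrite ltnS; apply: (@ltn_count _ _ _ _ x) => //=.
  + by move=> i /=; rewrite (mem_cat i (B ++ c)) negb_or => /andP[].
  + exact/over_mem/(allP Hoverd).
  + by rewrite (mem_cat x (B ++ c)) xd orbT.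
- by rewrite (all_cat _ (B ++ c)) Hover.
- case=> v Hv; apply: Hunsat; exists v => l phi H.
  by apply: Hv; rewrite mem_cat H.
Qed.

(** Arbitrary labels let one equivalence cover both initial sets of a tableaux proof. *)
Lemma closed_tableauP l l' phi chi :
  (exists T, tableau [:: Lab l phi; Lab l' chi] T /\ closed_tableau T) <->
  (forall v, ~~ (has_label l (eval v phi) && has_label l' (eval v chi))).
Proof.
split=> [[T [HT Hcl]] v|Hunsat].
  by have := closed_tableau_unsat v HT Hcl; rewrite /= andbT.
have HS : subformula_closed (subformulas phi ++ subformulas chi).
  by apply: subformula_closed_cat; apply: subformulas_closed.
have [||T [ET HT HclT]] :=
    @unsatisfiable_closable _ [::] [:: Lab l phi; Lab l' chi] HS.
- by rewrite /= /over /= !mem_cat !subformulas_refl orbT.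
- case=> v Hv; case/negP: (Hunsat v).
  by rewrite -![has_label _ _]/(sat v (Lab _ _)) !Hv // !inE eqxx ?orbT.
- by exists T.
Qed.

(** A countermodel gives [phi] a middle or top value and [chi] the value [Bot], so it satisfies
    exactly one of the two initial sets. *)
Theorem theorem8 : forall phi chi : formula,
  entails phi chi <-> tableaux_proof phi chi.
Proof.
move=> phi chi; split=> [H|[/closed_tableauP Hm /closed_tableauP Ht] v].
  by split; apply/closed_tableauP => v; move: (H v);
    case: (eval v phi) (eval v chi) => [|m|] [|n|] // /(_ _ erefl) [].
by move: (Hm v) (Ht v); case: (eval v phi) (eval v chi) => [|m|] [|n|].
Qed.
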